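(* Let $\bar D=(D,(M_0,\alpha_0),M_f)$ be a DPNIF with $D=(P,T,F,l,V,r,w)$ a safe and well-formed DPN over a finite set $\mathcal{E}$ of event signatures, and let $\mathcal{C}\subset\mathbb{R}$ be a finite set containing every constant occurring in a guard $r(t)$ or $w(t)$, $t\in T$, and every value $\alpha_0(v)$, $v\in V$. Then the algorithm described below (Algorithm 1) terminates on $\bar D$, and its output $\langle Q,q_0,\rightarrow,F\rangle$, with $F$ the set of computed states $(M,\tilde\alpha)$ with $M=M_f$, is the GFA induced by $\bar D$ (the algorithm is sound). Algorithm 1: initialize $Q:=\{(M_0,\tilde\alpha_0)\}$ with $\tilde\alpha_0(v)=[\alpha_0(v),\alpha_0(v)]$ for all $v\in V$, worklist $W:=\{(M_0,\tilde\alpha_0)\}$, $\rightarrow:=\emptyset$. While $W\neq\emptyset$: select and remove some $(M,\tilde\alpha)$ from $W$; for every $(t,\tilde\beta)\in enabled(M,\tilde\alpha)$: let $(M',\tilde\alpha'):=fire(M,t,\tilde\beta)$; if $(M',\tilde\alpha')\notin Q$, add it to both $Q$ and $W$; let $\psi:=l(t)$, and if $w(t)\not\equiv\top$ let $\psi:=\psi\wedge guard(t,\tilde\alpha')$; add $(M,\tilde\alpha)\xrightarrow{\psi}(M',\tilde\alpha')$ to $\rightarrow$. Here: $enabled(M,\tilde\alpha)$ is the (finite) set of pairs $(t,\tilde\beta)$ with $t\in T$ and $\tilde\beta$ a region assignment defined on $\mathrm{Var}_r(t)\cup\mathrm{Var}_w(t)$ (covering all combinations of regions of $\mathcal{P}_\mathcal{C}$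 satisfying $r(t)$ and $w(t)$) such that there exist a valuation $\alpha$ with $\alpha(v)\in\tilde\alpha(v)$ for all $v\in V$ and a partial valuation $\beta$ with $\beta(v)\in\tilde\beta(v)$ for which $t$ is enabled in $(M,\alpha)$ under $\beta$; $fire(M,t,\tilde\beta)$ returns $(M',\tilde\alpha')$ with $M'(p)=M(p)-F(p,t)+F(t,p)$ for all $p\in P$, $\tilde\alpha'(v)=\tilde\beta(v)$ for $v\in\mathrm{Var}_w(t)$ and $\tilde\alpha'(v)=\tilde\alpha(v)$ otherwise; $guard(t,\tilde\alpha')=\bigwedge_{v\in\mathrm{Var}(w(t))}\phi_v$, where $\phi_v$ is $v=c$ if $\tilde\alpha'(v)=[c,c]$, $v>c_i\wedge v<c_{i+1}$ if $\tilde\alpha'(v)=(c_i,c_{i+1})$, $v<c_1$ if $\tilde\alpha'(v)=(-\infty,c_1)$, and $v>c_m$ if $\tilde\alpha'(v)=(c_m,\infty)$.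
   Context: Event signatures: a finite set $\mathcal{E}$ of pairs $\langle n,A\rangle$ (activity name $n$, finite attribute set $A$), distinct names; $\mathcal{N}_\mathcal{E}$ is the set of names, $\mathcal{A}_\mathcal{E}$ the union of attribute sets. An event of signature $\langle n,A\rangle$ is $e=\langle n,\nu\rangle$ with $\nu:A\to\mathbb{R}$ total. Conditions $\mathcal{L}_\mathcal{E}$: $\varphi::=x\mid a\odot c\mid\neg\varphi\mid\varphi\wedge\varphi$ with $x\in\mathcal{N}_\mathcal{E}$, $a\in\mathcal{A}_\mathcal{E}$, $\odot\in\{<,=,>\}$, $c\in\mathbb{R}$; $e\models x$ iff $x=n$, $e\models a\odot c$ iff $\nu(a)$ is defined and $\nu(a)\odot c$, Boolean connectives as usual. Guards $\mathcal{G}_\mathcal{E}$ are conditions not mentioning names; an (partial) assignment $\alpha$ satisfies $a\odot c$ iff $\alpha(a)\odot c$; $\mathrm{Var}(\gamma)$ is the set of attributes in guard $\gamma$. A DPN is $D=(P,T,F,l,V,r,w)$: disjoint finite sets $P$ (places) and $T$ (transitions), flow $F:(P\times T)\cup(T\times P)\to\mathbb{N}$, labeling $l:T\to\mathcal{N}_\mathcal{E}\cup\{\tau\}$ ($\tau$ = silent), variables $V\subseteq\mathcal{A}_\mathcal{E}$, read and write guard functions $r,w:T\to\mathcal{G}_\mathcal{E}$; $\mathrm{Var}_r(t)=\mathrm{Var}(r(t))$, $\mathrm{Var}_w(t)=\mathrm{Var}(w(t))$, ${}^\bullet t=\{p\mid F(p,t)>0\}$. A state is $(M,\alpha)$ with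 $M:P\to\mathbb{N}$ and $\alpha:V\to\mathbb{R}$ total. Transition $t$ is enabled in $(M,\alpha)$ under a partial valuation $\beta:V\rightharpoonup\mathbb{R}$ iff $\beta$ is defined on $\mathrm{Var}_r(t)\cup\mathrm{Var}_w(t)$, $\beta(v)=\alpha(v)$ for $v\in\mathrm{Var}_r(t)$, $\beta\models r(t)$, $\beta\models w(t)$, and $M(p)\ge F(p,t)$ for all $p\in{}^\bullet t$. Firing yields $(M',\alpha')$ with $M'(p)=M(p)-F(p,t)+F(t,p)$, $\alpha'(v)=\beta(v)$ for $v\in\mathrm{Var}_w(t)$, $\alpha'(v)=\alpha(v)$ otherwise. Safe: every reachable marking assigns at most 1 token to each place. Well-formed: every visible $t$ with $l(t)=n$, $\langle n,A\rangle\in\mathcal{E}$, has $\mathrm{Var}_w(t)=A$, and every silent $t$ has $w(t)\equiv\top$. A DPNIF is $(D,(M_0,\alpha_0),M_f)$ with an initial state and a final marking. Interval abstraction: for $\mathcal{C}=\{c_1<\dots<c_m\}$, $\mathcal{P}_\mathcal{C}$ is the partition of $\mathbb{R}$ into $(-\infty,c_1)$, $(c_m,\infty)$, $[c_i,c_i]$ ($1\le i\le m$) and $(c_i,c_{i+1})$ ($1\le i<m$). A region assignment maps variables to elements of $\mathcal{P}_\mathcal{C}$; $\tilde\alpha$ denotes the region assignment sending $v$ to the region containing $\alpha(v)$. A guarded finite-state automaton (GFA) over $\mathcal{E}$ is $\langle Q,q_0,\rightarrow,F\rangle$ with finite state set $Q$, initial state $q_0$, transition relation $\rightarrow\subseteq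 Q\times\mathcal{L}_\mathcal{E}\times Q$ (here extended so that labels may use $\tau$ in place of a name), and final states $F\subseteq Q$. GFA induced by $\bar D$: let $S$ be the set of states reachable from $(M_0,\alpha_0)$; $(M,\alpha)\sim(M',\alpha')$ iff $M=M'$ and for every $v\in V$, $\alpha(v),\alpha'(v)$ lie in the same region of $\mathcal{P}_\mathcal{C}$; classes are represented as $(M,\tilde\alpha)$. Then $Q=S/{\sim}$; $q_0=(M_0,\tilde\alpha_0)$; $(M,\tilde\alpha)\xrightarrow{a\wedge\psi}(M',\tilde\alpha')$ iff there are $t\in T$ and $\beta$ with $(M,\alpha)$ firing $t$ under $\beta$ into $(M',\alpha')$ for some $\alpha,\alpha'$ with $\alpha(v)\in\tilde\alpha(v)$, $\alpha'(v)\in\tilde\alpha'(v)$ for all $v$, $a=l(t)$, and $\psi=\bigwedge_{v\in\mathrm{Var}(w(t))}\phi_v$ with $\phi_v$ as defined in the claim; $F=\{(M,\tilde\alpha)\mid M=M_f\}$. *)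

(* Defs.v *)
From Stdlib Require Import Reals List.
From mathcomp Require Import all_boot.

Set Implicit Arguments.
Unset Strict Implicit.
Unset Printing Implicit Defensive.

Inductive cmp := CLt | CEq | CGt.

Definition cmpR (o : cmp) (x c : R) : Prop :=
  match o with CLt => Rlt x c | CEq => x = c | CGt => Rgt x c end.

(** Elements of the partition P_C :  (-oo,c) | [c,c] | (a,b) | (c,+oo);
    RAll = the single region R, used only when C is empty. *)
Inductive region :=
  | RBelow (c : R) | RPoint (c : R) | RBetween (a b : R) | RAbove (c : R) | RAll.

Definition in_region (x : R) (r : region) : Prop :=
  match r with
  | RBelow c => Rlt x c
  | RPoint c => x = c
  | RBetween a b => Rlt a x /\ Rlt x b
  | RAbove c => Rgt x c
  | RAll => True
  end.

(** [is_region C r] : r is an element of the partition P_C (C a finite set, as a list). *)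
Definition is_region (C : seq R) (r : region) : Prop :=
  match r with
  | RBelow c => List.In c C /\ (forall d, List.In d C -> Rle c d)
  | RAbove c => List.In c C /\ (forall d, List.In d C -> Rle d c)
  | RPoint c => List.In c C
  | RBetween a b => List.In a C /\ List.In b C /\ Rlt a b /\
                    (forall d, List.In d C -> ~ (Rlt a d /\ Rlt d b))
  | RAll => C = nil
  end.

Section DPNs.
Variables (Name : Type) (Att P T : finType).

(** * Guards (conditions not mentioning names; ⊤ is included as a primitive) *)
Inductive guard :=
  | GTrue
  | GAtom (a : Att) (o : cmp) (c : R)
  | GNot (g : guard)
  | GAnd (g1 g2 : guard).

Fixpoint gvars (g : guard) : {set Att} :=
  match g with
  | GTrue => set0
  | GAtom a _ _ => [set a]
  | GNot g => gvars g
  | GAnd g1 g2 => gvars g1 :|: gvars g2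
  end.

Fixpoint gconsts (g : guard) : seq R :=
  match g with
  | GTrue => [::]
  | GAtom _ _ c => [:: c]
  | GNot g => gconsts g
  | GAnd g1 g2 => gconsts g1 ++ gconsts g2
  end.

Definition pval := {ffun Att -> option R}.

Fixpoint gsat (b : Att -> option R) (g : guard) : Prop :=
  match g with
  | GTrue => True
  | GAtom a o c => exists x, b a = Some x /\ cmpR o x c
  | GNot g => ~ gsat b g
  | GAnd g1 g2 => gsat b g1 /\ gsat b g2
  end.

(** * Conditions (GFA labels), names extended with tau = None *)
Inductive cond :=
  | CName (x : option Name)
  | CAtom (a : Att) (o : cmp) (c : R)
  | CNot (f : cond)
  | CAnd (f1 f2 : cond).

Fixpoint csat (n : option Name) (nu : Att -> option R) (f : cond) : Prop :=
  match f with
  | CName x => x = n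
  | CAtom a o c => exists y, nu a = Some y /\ cmpR o y c
  | CNot f => ~ csat n nu f
  | CAnd f1 f2 => csat n nu f1 /\ csat n nu f2
  end.

Definition cond_equiv (f1 f2 : cond) : Prop :=
  forall n nu, csat n nu f1 <-> csat n nu f2.

(** ⊤ as an abbreviation inside the condition grammar *)
Definition ctrue : cond := CNot (CAnd (CName None) (CNot (CName None))).

Record DPN := MkDPN {
  Fin : P -> T -> nat;
  Fout : T -> P -> nat;
  lab : T -> option Name;       (* None = tau *)
  V : {set Att};
  rg : T -> guard;
  wg : T -> guard }.

Definition marking := {ffun P -> nat}.

Definition rvars (D : DPN) t := gvars (rg D t).
Definition wvars (D : DPN) t := gvars (wg D t).

Definition enabled (D : DPN) (M : marking) (a : pval) (t : T) (b : pval) : Prop :=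
  (forall v, v \in rvars D t :|: wvars D t -> b v <> None) /\
  (forall v, b v <> None -> v \in V D) /\
  (forall v, v \in rvars D t -> b v = a v) /\
  gsat b (rg D t) /\ gsat b (wg D t) /\
  (forall p, Fin D p t <= M p).

Definition fire_m (D : DPN) (M : marking) (t : T) : marking :=
  [ffun p => M p - Fin D p t + Fout D t p].

Definition fire_v (D : DPN) (a : pval) (t : T) (b : pval) : pval :=
  [ffun v => if v \in wvars D t then b v else a v].

Inductive reach (D : DPN) (M0 : marking) (a0 : pval) : marking -> pval -> Prop :=
  | reach_init : reach D M0 a0 M0 a0
  | reach_step M a t b :
      reach D M0 a0 M a -> enabled D M a t b ->
      reach D M0 a0 (fire_m D M t) (fire_v D a t b).

Definition safe (D : DPN) (M0 : marking) (a0 : pval) : Prop :=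
  forall M a, reach D M0 a0 M a -> forall p, M p <= 1.

Definition attrsE (E : seq (Name * {set Att})) : {set Att} := \bigcup_(x <- E) x.2.

Definition DPN_over (E : seq (Name * {set Att})) (D : DPN) : Prop :=
  V D \subset attrsE E /\
  (forall t, rvars D t \subset attrsE E /\ wvars D t \subset attrsE E) /\
  (forall t n, lab D t = Some n -> List.In n (map fst E)).

Definition well_formed (E : seq (Name * {set Att})) (D : DPN) : Prop :=
  (forall t n A, lab D t = Some n -> List.In (n, A) E -> wvars D t = A) /\
  (forall t, lab D t = None -> forall b : pval, gsat b (wg D t)).

Definition rval := {ffun Att -> option region}.
Definition astate := (marking * rval)%type.

Definition in_aregion (b : Att -> option R) (rb : Att -> option region) : Prop :=
  forall v, match b v, rb v with
            | Some x, Some r => in_region x r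
            | None, None => True
            | _, _ => False
            end.

Definition abs_val (C : seq R) (a : Att -> option R) (ra : Att -> option region) : Prop :=
  in_aregion a ra /\ (forall v r, ra v = Some r -> is_region C r).

Definition phi (v : Att) (r : option region) : cond :=
  match r with
  | Some (RPoint c) => CAtom v CEq c
  | Some (RBetween a b) => CAnd (CAtom v CGt a) (CAtom v CLt b)
  | Some (RBelow c) => CAtom v CLt c
  | Some (RAbove c) => CAtom v CGt c
  | _ => ctrue
  end.

Definition guard_of (D : DPN) (t : T) (ra : rval) : cond :=
  foldr (fun v acc => CAnd (phi v (ra v)) acc) ctrue (enum (wvars D t)).

Definition ind_Q (D : DPN) (C : seq R) (M0 : marking) (a0 : pval) (s : astate) : Prop :=
  exists M a, reach D M0 a0 M a /\ s.1 = M /\ abs_val C a s.2.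

Definition ind_q0 (C : seq R) (M0 : marking) (a0 : pval) (s : astate) : Prop :=
  s.1 = M0 /\ abs_val C a0 s.2.

Definition ind_trans (D : DPN) (C : seq R) (M0 : marking) (a0 : pval)
    (s : astate) (psi : cond) (s' : astate) : Prop :=
  ind_Q D C M0 a0 s /\ ind_Q D C M0 a0 s' /\
  exists t (a b : pval),
    abs_val C a s.2 /\ enabled D s.1 a t b /\
    s'.1 = fire_m D s.1 t /\ abs_val C (fire_v D a t b) s'.2 /\
    psi = CAnd (CName (lab D t)) (guard_of D t s'.2).

(** * Algorithm 1, as a nondeterministic small-step transition system *)
Record config := Config {
  cQ : seq astate;
  cW : seq astate;
  cTr : seq (astate * cond * astate) }.

Definition enabled_abs (D : DPN) (C : seq R) (s : astate) (e : T * rval) : Prop :=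
  (forall v, v \in rvars D e.1 :|: wvars D e.1 <-> e.2 v <> None) /\
  (forall v r, e.2 v = Some r -> is_region C r) /\
  exists a b : pval, in_aregion a s.2 /\ in_aregion b e.2 /\ enabled D s.1 a e.1 b.

Definition afire (D : DPN) (s : astate) (t : T) (rb : rval) : astate :=
  (fire_m D s.1 t, [ffun v => if v \in wvars D t then rb v else s.2 v]).

Definition alg_label (D : DPN) (t : T) (s' : astate) (psi : cond) : Prop :=
  (wg D t = GTrue /\ psi = CName (lab D t)) \/
  (wg D t <> GTrue /\ psi = CAnd (CName (lab D t)) (guard_of D t s'.2)).

Definition process_one (D : DPN) (s : astate) (e : T * rval) (c c' : config) : Prop :=
  let s' := afire D s e.1 e.2 in
  exists psi, alg_label D e.1 s' psi /\
  ((List.In s' (cQ c) /\ cQ c' = cQ c /\ cW c' = cW c) \/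
   (~ List.In s' (cQ c) /\ cQ c' = s' :: cQ c /\ cW c' = s' :: cW c)) /\
  cTr c' = (s, psi, s') :: cTr c.

Inductive process_all (D : DPN) (s : astate) : seq (T * rval) -> config -> config -> Prop :=
  | pa_nil c : process_all D s [::] c c
  | pa_cons e es c c1 c2 :
      process_one D s e c c1 -> process_all D s es c1 c2 -> process_all D s (e :: es) c c2.

Definition alg_step (D : DPN) (C : seq R) (c c' : config) : Prop :=
  exists s W1 W2 (es : seq (T * rval)),
    cW c = W1 ++ s :: W2 /\
    List.NoDup es /\ (forall e, List.In e es <-> enabled_abs D C s e) /\
    process_all D s es (Config (cQ c) (W1 ++ W2) (cTr c)) c'.

Definition init_astate (M0 : marking) (a0 : pval) : astate :=
  (M0, [ffun v => omap RPoint (a0 v)]).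

Definition alg_init (s0 : astate) : config := Config [:: s0] [:: s0] [::].

Inductive alg_reach (D : DPN) (C : seq R) (c0 : config) : config -> Prop :=
  | ar_init : alg_reach D C c0 c0
  | ar_step c c' : alg_reach D C c0 c -> alg_step D C c c' -> alg_reach D C c0 c'.

(** termination: no infinite run, and no run gets stuck while W is nonempty *)
Definition alg_terminates (D : DPN) (C : seq R) (c0 : config) : Prop :=
  Acc (fun c' c => alg_step D C c c') c0 /\
  (forall c, alg_reach D C c0 c -> cW c <> [::] -> exists c', alg_step D C c c').

(** the output <Q, q0, ->, F> of a final configuration is the induced GFA
    (transition labels compared up to logical equivalence) *)
Definition output_is_induced (D : DPN) (C : seq R) (M0 Mf : marking) (a0 : pval)
    (c : config) : Prop :=
  (forall s, List.In s (cQ c) <-> ind_Q D C M0 a0 s) /\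
  ind_q0 C M0 a0 (init_astate M0 a0) /\
  (forall s, (List.In s (cQ c) /\ s.1 = Mf) <-> (ind_Q D C M0 a0 s /\ s.1 = Mf)) /\
  (forall s psi s', List.In (s, psi, s') (cTr c) ->
     exists psi', ind_trans D C M0 a0 s psi' s' /\ cond_equiv psi psi') /\
  (forall s psi s', ind_trans D C M0 a0 s psi s' ->
     exists psi', List.In (s, psi', s') (cTr c) /\ cond_equiv psi psi').

End DPNs.

(* Main.v *)
(* The guards of D only compare variables with constants of C, so two
   valuations whose variables lie in the same regions of P_C satisfy the same
   guards.  Hence firing commutes with the region abstraction on reachable
   states: an abstractly enabled pair (t, rb) can be replayed from every
   concrete representative of a reachable abstract state, and every concrete
   firing is abstracted by some element of enabled(M, ra).  By induction, the
   worklist algorithm therefore collects exactly the abstractions of reachable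
   states and the induced transitions.  It terminates because safety confines
   these abstract states to a finite set of size N, while every iteration
   removes one state from W and adds to W only states new to Q, so that
   2 (N - |Q|) + |W| decreases. *)

Require Import Defs.
From Stdlib Require Import Reals List Lra Lia Classical.
From mathcomp Require Import all_boot zify.

Set Implicit Arguments.
Unset Strict Implicit.
Unset Printing Implicit Defensive.

Lemma In_cat (A : Type) (x : A) (s1 s2 : seq A) :
  In x (s1 ++ s2) <-> In x s1 \/ In x s2.
Proof. by elim: s1 => [|y s1 IH] /=; [tauto | rewrite IH; tauto]. Qed.

Lemma In_mem (X : eqType) (x : X) (s : seq X) : x \in s -> In x s.
Proof. by elim: s => //= y s IH; rewrite in_cons => /predU1P [->|/IH]; [left|right]. Qed.

Lemma exists_NoDup_enum (A : Type) (Q : A -> Prop) (l : seq A) :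
  (forall x, Q x -> In x l) -> exists es, NoDup es /\ forall x, In x es <-> Q x.
Proof.
elim: l Q => [|y l IH] Q Ql; first by exists [::]; split=> [|x]; [constructor | split=> // /Ql].
have [es [es_uniq es_Q]] : exists es, NoDup es /\ forall x, In x es <-> Q x /\ x <> y.
  by apply: IH => x [/Ql [->|] //].
case: (classic (Q y)) => Qy.
- exists (y :: es); split; first by constructor=> // /es_Q [].
  move=> x /=; rewrite es_Q; split=> [[<-|[]] //|Qx].
  by case: (classic (y = x)) => [|yx]; [left | right; split=> // xy; case: yx].
- exists es; split=> // x; rewrite es_Q; split=> [[] //|Qx]; split=> // xy.
  by case: Qy; rewrite -xy.
Qed.

Lemma exists_greatest (A : Type) (le : A -> A -> Prop) (Q : A -> Prop) (l : seq A) :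
  (forall x y, le x y \/ le y x) -> (forall x y z, le x y -> le y z -> le x z) ->
  (exists2 d, In d l & Q d) ->
  exists m, [/\ In m l, Q m & forall d, In d l -> Q d -> le d m].
Proof.
move=> total trans; have refl x : le x x by case: (total x x).
elim: l => [|x l IH] [d d_in Qd]; first by case: d_in.
case: (classic (exists2 d, In d l & Q d)) => [/IH [m [m_in Qm m_max]]|none].
- case: (classic (Q x /\ le m x)) => [[Qx le_mx]|not_x].
  + exists x; split=> [|//|y [<-//|y_in Qy]]; first by left.
    exact: trans (m_max y y_in Qy) le_mx.
  + exists m; split=> [|//|y [<- Qy|y_in]]; [by right | | exact: m_max].
    by case: (total x m) => // le_mx; exfalso; exact: not_x.
- have Qx : Q x by case: d_in => [->//|d_in]; case: none; exists d.
  exists x; split=> [|//|y [<-//|y_in Qy]]; first by left.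
  by case: none; exists y.
Qed.

Lemma size_length (A : Type) (s : seq A) : size s = length s.
Proof. by elim: s => //= x s ->. Qed.

Lemma NoDup_size_le_card (A : Type) (K : finType) (f : K -> A) (l : seq A) :
  NoDup l -> (forall y, In y l -> exists x, f x = y) -> size l <= #|K|.
Proof.
move=> l_uniq l_f; rewrite cardE !size_length -(length_map f); apply/leP.
apply: NoDup_incl_length l_uniq _ => y /l_f [x <-].
by apply: in_map; apply: In_mem; rewrite mem_enum.
Qed.

Lemma Acc_measure (A : Type) (step : A -> A -> Prop) (I : A -> Prop) (f : A -> nat) :
  (forall c c', I c -> step c c' -> I c' /\ f c' < f c) ->
  forall c, I c -> Acc (fun c' c => step c c') c.
Proof.
move=> dec c; have [n] := ubnP (f c); elim: n c => [|n IH] c lt_fc Ic.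
  by rewrite ltn0 in lt_fc.
constructor=> c' step_c; have [Ic' lt'] := dec c c' Ic step_c.
by apply: IH Ic'; apply: leq_trans lt' _; rewrite -ltnS.
Qed.

Section Regions.
Local Open Scope R_scope.
Variable C : seq R.

Lemma Rle_total x y : x <= y \/ y <= x.
Proof. by case: (Rle_lt_dec x y) => h; [left | right; lra]. Qed.

Lemma region_exists (x : R) : exists2 r, is_region C r & in_region x r.
Proof.
case: (classic (C = [::])) => [->|C_nil]; first by exists RAll.
case: (classic (In x C)) => [x_in|x_notin]; first by exists (RPoint x).
have [below|none_below] := classic (exists2 d, In d C & d < x);
have [above|none_above] := classic (exists2 d, In d C & x < d).
- have [a [a_in ax a_max]] := exists_greatest Rle_total Rle_trans below.
  have [b [b_in xb b_min]] := exists_greatest (le := fun x y => y <= x)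
    (fun x y => Rle_total y x) (fun x y z h1 h2 => Rle_trans z y x h2 h1) above.
  exists (RBetween a b) => //; split=> //; split=> //; split=> [|d d_in [ad db]]; first lra.
  case: (Rtotal_order d x) => [/(a_max d d_in)|[dx|/(b_min d d_in)]]; [lra | | lra].
  by case: x_notin; rewrite -dx.
- have [a [a_in ax a_max]] := exists_greatest Rle_total Rle_trans below.
  exists (RAbove a) => //; split=> // d d_in.
  case: (Rtotal_order d x) => [/(a_max d d_in)//|[dx|xd]]; first by case: x_notin; rewrite -dx.
  by case: none_above; exists d.
- have [b [b_in xb b_min]] := exists_greatest (le := fun x y => y <= x)
    (fun x y => Rle_total y x) (fun x y z h1 h2 => Rle_trans z y x h2 h1) above.
  exists (RBelow b) => //; split=> // d d_in.
  case: (Rtotal_order d x) => [dx|[dx|/(b_min d d_in)]]; [|by case: x_notin; rewrite -dx|lra].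
  by case: none_below; exists d.
- case: C C_nil none_below none_above x_notin => [//|c l] _ nb na x_notin.
  case: (Rtotal_order c x) => [cx|[cx|xc]].
  + by case: nb; exists c => //; left.
  + by case: x_notin; left.
  + by case: na; exists c => //; left.
Qed.

Lemma not_strictly_between a b c : ~ (a < c /\ c < b) -> c <= a \/ b <= c.
Proof.
move=> not_in; case: (Rle_lt_dec c a) => ca; first by left.
by case: (Rle_lt_dec b c) => bc; [right | case: not_in].
Qed.

(* Instantiate the extremality conditions of [is_region] at the constants of
   [C] in context, backtracking over the choices, until [lra] applies. *)
Ltac region_lra :=
  first [ lra
        | match goal with
          | Hf : forall d, In d _ -> _, Hc : In ?c _ |- _ =>
            let h := fresh "h" in
            have h := Hf c Hc; clear Hf; (destruct h as [h|h] || idtac); region_lra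
          end ].

Ltac split_region_hyps :=
  repeat match goal with H : _ /\ _ |- _ => destruct H end;
  repeat match goal with
  | Hf : forall d, In d _ -> ~ _ |- _ => have {}Hf := fun d h => not_strictly_between (Hf d h)
  end.

Lemma region_unique x r1 r2 :
  is_region C r1 -> is_region C r2 -> in_region x r1 -> in_region x r2 -> r1 = r2.
Proof.
case: r1 => [c|c|a b|c|]; case: r2 => [c'|c'|a' b'|c'|] //= H1 H2 H3 H4;
  split_region_hyps; subst; try done;
  repeat match goal with H : In _ [::] |- _ => by case: H end.
all: first [ by exfalso; region_lra | by f_equal; region_lra ].
Qed.

Lemma region_cmp r x y c o : is_region C r -> in_region x r -> in_region y r -> In c C ->
  cmpR o x c <-> cmpR o y c.
Proof.
case: r => [c0|c0|a b|c0|] /= H1 H2 H3 c_in; split_region_hyps; subst; try by [].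
all: case: o => /=; split=> ?; region_lra.
Qed.

Definition regions_of : seq region :=
  RAll :: flat_map (fun c => RBelow c :: RPoint c :: RAbove c :: List.map (RBetween c) C) C.

Lemma regions_of_complete r : is_region C r -> In r regions_of.
Proof.
case: r => [c [c_in _]|c c_in|a b [a_in [b_in _]]|c [c_in _]|] /=; try by left.
all: right; apply/in_flat_map.
- by exists c; split=> //; left.
- by exists c; split=> //; right; left.
- by exists a; split=> //; do 3 right; exact: in_map.
- by exists c; split=> //; right; right; left.
Qed.

End Regions.

Definition same_region (C : seq R) (ox oy : option R) : Prop :=
  ox = oy \/
  exists x y r, [/\ ox = Some x, oy = Some y, is_region C r, in_region x r & in_region y r].

Lemma same_region_None C ox oy : same_region C ox oy -> oy = None -> ox = None.
Proof. by case=> [->|[x [y [r [_ ->]]]]]. Qed.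

Lemma gsat_same_region (Att : finType) (C : seq R) (g : guard Att) (b b' : Att -> option R) :
  (forall c, In c (gconsts g) -> In c C) ->
  (forall v, v \in gvars g -> same_region C (b v) (b' v)) ->
  gsat b g <-> gsat b' g.
Proof.
elim: g => [|a o c|g IH|g1 IH1 g2 IH2] //= C_g same.
- have c_in : In c C by apply: C_g; left.
  case: (same a (set11 a)) => [->//|[x [y [r [-> -> r_C xr yr]]]]].
  by split=> -[z [[<-] cmp_z]]; [exists y | exists x]; split=> //; apply/(region_cmp o r_C xr yr).
- by have := IH C_g same; tauto.
- have /IH1 sat1 : forall c, In c (gconsts g1) -> In c C by move=> c h; apply/C_g/In_cat; left.
  have /IH2 sat2 : forall c, In c (gconsts g2) -> In c C by move=> c h; apply/C_g/In_cat; right.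
  have /sat1 : forall v, v \in gvars g1 -> same_region C (b v) (b' v).
    by move=> v h; apply: same; rewrite in_setU h.
  have /sat2 : forall v, v \in gvars g2 -> same_region C (b v) (b' v).
    by move=> v h; apply: same; rewrite in_setU h orbT.
  tauto.
Qed.

Section Abstraction.
Variables (Att : finType) (C : seq R).
Implicit Types (a b : Att -> option R) (ra rb : Att -> option region).

Lemma region_assignments_agree a b ra rb v :
  (forall r, ra v = Some r -> is_region C r) -> (forall r, rb v = Some r -> is_region C r) ->
  in_aregion a ra -> in_aregion b rb -> a v = b v -> ra v = rb v.
Proof.
move=> ra_C rb_C /(_ v) a_ra /(_ v) b_rb ab; move: a_ra b_rb ra_C rb_C; rewrite ab.
case: (b v) => [x|]; case: (ra v) => [r|]; case: (rb v) => [r'|] //= xr xr' r_C r'_C.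
by rewrite (region_unique (r_C r erefl) (r'_C r' erefl) xr xr').
Qed.

Lemma abs_val_uniq a (ra ra' : rval Att) : abs_val C a ra -> abs_val C a ra' -> ra = ra'.
Proof.
move=> [a_ra ra_C] [a_ra' ra'_C]; apply/ffunP => v.
exact: region_assignments_agree (ra_C v) (ra'_C v) a_ra a_ra' erefl.
Qed.

Lemma abs_val_exists a : exists ra : rval Att, abs_val C a ra.
Proof.
have /fin_all_exists [f f_spec] : forall v, exists o : option region,
    match a v, o with
    | Some x, Some r => is_region C r /\ in_region x r
    | None, None => True
    | _, _ => False
    end.
  move=> v; case: (a v) => [x|]; last by exists None.
  by have [r r_C xr] := region_exists C x; exists (Some r).
exists [ffun v => f v]; split=> v; rewrite ffunE; move: (f_spec v);
  case: (a v) => [x|]; case: (f v) => [r|] //=; first by case.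
by move=> [r_C _] _ [<-].
Qed.

Lemma in_aregion_same_region a a' ra v :
  in_aregion a ra -> abs_val C a' ra -> same_region C (a v) (a' v).
Proof.
move=> /(_ v) a_ra [/(_ v) a'_ra /(_ v) ra_C]; move: ra_C a_ra a'_ra.
case: (ra v) => [r /(_ r erefl) r_C|_]; case: (a v) => [x|]; case: (a' v) => [y|] //= xr yr.
  by right; exists x, y, r.
by left.
Qed.

Definition override (A : Type) (X : {set Att}) (f g : {ffun Att -> option A}) :
  {ffun Att -> option A} := [ffun v => if v \in X then f v else g v].

Definition restrict (A : Type) (X : {set Att}) (f : {ffun Att -> option A}) :
  {ffun Att -> option A} := override X f [ffun => None].

Lemma abs_val_override X (a b : pval Att) (ra rb : rval Att) :
  abs_val C a ra -> abs_val C b rb -> abs_val C (override X a b) (override X ra rb).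
Proof.
move=> [a_ra ra_C] [b_rb rb_C]; split=> v; rewrite !ffunE; case: (v \in X).
- exact: a_ra.
- exact: b_rb.
- exact: ra_C.
- exact: rb_C.
Qed.

Lemma abs_val_restrict X (b : pval Att) (rb : rval Att) :
  abs_val C b rb -> abs_val C (restrict X b) (restrict X rb).
Proof. by move=> b_rb; apply: abs_val_override => //; split=> v; rewrite !ffunE. Qed.

Lemma in_aregion_None (b : Att -> option R) (rb : Att -> option region) v :
  in_aregion b rb -> (b v = None <-> rb v = None).
Proof. by move=> /(_ v); case: (b v); case: (rb v). Qed.

End Abstraction.

Section Algorithm.
Variables (Name : Type) (Att P T : finType) (D : DPN Name Att P T) (C : seq R).
Variables (M0 : {ffun P -> nat}) (a0 : {ffun Att -> option R}).
Hypothesis guard_consts :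
  forall t c, In c (gconsts (rg D t)) \/ In c (gconsts (wg D t)) -> In c C.

Local Notation reachable_abs := (ind_Q D C M0 a0).
Local Notation induced_label t s' := (CAnd (CName Att (lab D t)) (guard_of D t s'.2)).

Lemma guards_same_region t (b b' : Att -> option R) :
  (forall v, v \in rvars D t :|: wvars D t -> same_region C (b v) (b' v)) ->
  gsat b (rg D t) -> gsat b (wg D t) -> gsat b' (rg D t) /\ gsat b' (wg D t).
Proof.
move=> same sat_r sat_w; split.
- apply/(gsat_same_region (b := b)) => // [c c_r|v v_r]; first exact: guard_consts (or_introl c_r).
  by apply: same; rewrite in_setU v_r.
- apply/(gsat_same_region (b := b)) => // [c c_w|v v_w]; first exact: guard_consts (or_intror c_w).
  by apply: same; rewrite in_setU v_w orbT.
Qed.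

Lemma enabled_restrict M (a b : pval Att) t :
  enabled D M a t b -> enabled D M a t (restrict (rvars D t :|: wvars D t) b).
Proof.
move=> [dom [in_V [read [sat_r [sat_w tokens]]]]].
set b' := restrict _ b.
have b'E v : b' v = if v \in rvars D t :|: wvars D t then b v else None.
  by rewrite /b' /restrict /override !ffunE.
have [sat_r' sat_w'] : gsat b' (rg D t) /\ gsat b' (wg D t).
  by apply: guards_same_region sat_r sat_w => v v_S; left; rewrite b'E v_S.
split; [|split; [|split; [|split; [|split]]]] => //.
- by move=> v v_S; rewrite b'E v_S; exact: dom.
- by move=> v; rewrite b'E; case: ifP => // _; exact: in_V.
- by move=> v v_r; rewrite b'E in_setU v_r; exact: read.
Qed.

Lemma enabled_read_override M (a a1 b : pval Att) (ra : rval Att) t :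
  abs_val C a1 ra -> in_aregion a ra -> enabled D M a t b ->
  enabled D M a1 t (override (rvars D t) a1 b).
Proof.
move=> a1_ra a_ra [dom [in_V [read [sat_r [sat_w tokens]]]]].
set b1 := override _ a1 b.
have b1E v : b1 v = if v \in rvars D t then a1 v else b v by rewrite ffunE.
have same v : v \in rvars D t -> same_region C (b v) (b1 v).
  by move=> v_r; rewrite b1E v_r read //; exact: in_aregion_same_region a_ra a1_ra.
have [sat_r1 sat_w1] : gsat b1 (rg D t) /\ gsat b1 (wg D t).
  apply: guards_same_region sat_r sat_w => v _.
  by case v_r: (v \in rvars D t); [exact: same | left; rewrite b1E v_r].
split; [|split; [|split; [|split; [|split]]]] => //.
- move=> v v_S; case v_r: (v \in rvars D t); last by rewrite b1E v_r; exact: dom.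
  by move=> /(same_region_None (same v v_r)); exact: dom.
- move=> v; rewrite b1E; case: ifP => [v_r _|_]; last exact: in_V.
  by apply/in_V/dom; rewrite in_setU v_r.
- by move=> v v_r; rewrite b1E v_r.
Qed.

Lemma abs_val_read_override (a a1 b : pval Att) (ra rb : rval Att) t :
  abs_val C a1 ra -> in_aregion a ra -> abs_val C b rb ->
  (forall v, v \in rvars D t -> b v = a v) ->
  abs_val C (override (rvars D t) a1 b) rb.
Proof.
move=> a1_ra a_ra b_rb read.
have -> : rb = override (rvars D t) ra rb.
  apply/ffunP => v; rewrite ffunE; case: ifP => // v_r.
  apply: region_assignments_agree (read v v_r) => //.
  - exact: b_rb.2.
  - exact: a1_ra.2.
  - exact: b_rb.1.
exact: abs_val_override.
Qed.

Lemma reachable_abs_afire s t rb :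
  reachable_abs s -> enabled_abs D C s (t, rb) -> reachable_abs (afire D s t rb).
Proof.
move=> [M [a1 [reach_a1 [s_M a1_s]]]] [_ [rb_C [a [b [a_s [b_rb en]]]]]] /=.
(* The witness [a] need not be reachable: replay the firing from the reachable
   [a1], which lies in the same regions, keeping the values written by [b]. *)
have b_abs : abs_val C b rb by [].
have en1 := enabled_read_override a1_s a_s en.
have b1_abs := abs_val_read_override a1_s a_s b_abs en.2.2.1.
rewrite s_M in en1.
exists (fire_m D M t), (fire_v D a1 t (override (rvars D t) a1 b)).
split; first exact: reach_step reach_a1 en1.
by split; [rewrite /= s_M | exact: (abs_val_override (wvars D t) b1_abs a1_s)].
Qed.

Lemma enabled_abs_complete (s : astate Att P) (a b : pval Att) t :
  abs_val C a s.2 -> enabled D s.1 a t b ->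
  exists rb, enabled_abs D C s (t, rb) /\ abs_val C (fire_v D a t b) (afire D s t rb).2.
Proof.
move=> a_s en; have [rab b_rab] := abs_val_exists C b.
set S := rvars D t :|: wvars D t.
exists (restrict S rab); split; first split=> /=.
- move=> v; rewrite /restrict /override !ffunE; case: ifP => v_S; last by split.
  by split=> // _; rewrite -(in_aregion_None v b_rab.1); exact: en.1.
- split; first exact: (abs_val_restrict S b_rab).2.
  exists a, (restrict S b); split; first exact: a_s.1.
  split; [exact: (abs_val_restrict S b_rab).1 | rewrite /S; exact: (enabled_restrict en)].
- have -> : (afire D s t (restrict S rab)).2 = override (wvars D t) rab s.2.
    apply/ffunP => v; rewrite !ffunE; case: ifP => // v_w.
    by rewrite /S in_setU v_w orbT.
  exact: (abs_val_override (wvars D t) b_rab a_s).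
Qed.

Lemma alg_label_equiv t s' psi : alg_label D t s' psi ->
  cond_equiv psi (induced_label t s').
Proof.
case=> [[w_true ->]|[_ ->]] n nu //.
by rewrite /guard_of /wvars w_true /= enum_set0 /=; tauto.
Qed.

Definition processed (c : config Name Att P) (s : astate Att P) (e : T * rval Att) : Prop :=
  let s' := afire D s e.1 e.2 in
  In s' (cQ c) /\ exists psi, alg_label D e.1 s' psi /\ In (s, psi, s') (cTr c).

Definition sound_transition (x : astate Att P * cond Name Att * astate Att P) : Prop :=
  let: (s, psi, s') := x in
  reachable_abs s /\
  exists e, [/\ enabled_abs D C s e, s' = afire D s e.1 e.2 & alg_label D e.1 s' psi].

Record sound_config (c : config Name Att P) : Prop := {
  cQ_reachable : forall s, In s (cQ c) -> reachable_abs s;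
  cQ_NoDup : NoDup (cQ c);
  cTr_sound : forall x, In x (cTr c) -> sound_transition x }.

Definition extends (c c' : config Name Att P) : Prop :=
  exists new, [/\ cQ c' = new ++ cQ c, cW c' = new ++ cW c & incl (cTr c) (cTr c')].

Lemma extends_refl c : extends c c.
Proof. by exists [::]; split=> //; exact: incl_refl. Qed.

Lemma extends_trans c1 c2 c3 : extends c1 c2 -> extends c2 c3 -> extends c1 c3.
Proof.
move=> [new1 [Q2 W2 Tr2]] [new2 [Q3 W3 Tr3]].
exists (new2 ++ new1); rewrite -!catA -Q2 -W2; split=> //; exact: incl_tran Tr2 Tr3.
Qed.

Lemma processed_extends c c' s e : extends c c' -> processed c s e -> processed c' s e.
Proof.
move=> [new [Q' _ Tr']] [s'_in [psi [lab_psi tr_in]]].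
split; first by rewrite Q'; apply/In_cat; right.
by exists psi; split=> //; exact: Tr'.
Qed.

Lemma process_one_spec s e c c1 :
  process_one D s e c c1 -> reachable_abs s -> enabled_abs D C s e -> sound_config c ->
  [/\ sound_config c1, extends c c1 & processed c1 s e].
Proof.
case: e => t rb; set s' := afire D s t rb.
move=> [psi [lab_psi [[[s'_in [Q1 W1]]|[s'_new [Q1 W1]]] Tr1]]] s_reach en
  [Q_reach Q_uniq Tr_ok].
- have new_ok : sound_transition (s, psi, s') by split=> //; exists (t, rb).
  split; [split | exists [::] | split].
  + by rewrite Q1.
  + by rewrite Q1.
  + by rewrite Tr1 => x [<-|]; [| exact: Tr_ok].
  + by rewrite Q1 W1 Tr1; split=> // x; right.
  + by rewrite Q1.
  + by exists psi; rewrite Tr1; split=> //; left.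
- have new_ok : sound_transition (s, psi, s') by split=> //; exists (t, rb).
  split; [split | exists [:: s'] | split].
  + rewrite Q1 => x [<-|]; [exact: reachable_abs_afire | exact: Q_reach].
  + by rewrite Q1; constructor.
  + by rewrite Tr1 => x [<-|]; [| exact: Tr_ok].
  + by rewrite Q1 W1 Tr1; split=> // x; right.
  + by rewrite Q1; left.
  + by exists psi; rewrite Tr1; split=> //; left.
Qed.

Lemma process_all_spec s es c c' :
  process_all D s es c c' -> reachable_abs s -> (forall e, In e es -> enabled_abs D C s e) ->
  sound_config c -> [/\ sound_config c', extends c c' & forall e, In e es -> processed c' s e].
Proof.
elim=> {es c c'} [c|e es c c1 c2 one all IH] s_reach es_en c_ok.
  by split=> //; exact: extends_refl.
have [c1_ok ext1 proc1] := process_one_spec one s_reach (es_en e (or_introl erefl)) c_ok.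
have [c2_ok ext2 proc2] := IH s_reach (fun e' h => es_en e' (or_intror h)) c1_ok.
split=> //; first exact: extends_trans ext1 ext2.
by move=> e' [<-|/proc2]; [exact: processed_extends proc1 |].
Qed.

Hypothesis init_consts : forall v x, a0 v = Some x -> In x C.

Local Notation s0 := (init_astate M0 a0).

Lemma init_abs : abs_val C a0 s0.2.
Proof.
by split=> v; rewrite ffunE; case a0v: (a0 v) => [x|] //= r [<-]; exact: init_consts a0v.
Qed.

Lemma reachable_init : reachable_abs s0.
Proof. by exists M0, a0; split; [exact: reach_init | split; [| exact: init_abs]]. Qed.

Record alg_invariant (c : config Name Att P) : Prop := {
  inv_sound : sound_config c;
  inv_init : In s0 (cQ c);
  inv_W_in_Q : incl (cW c) (cQ c);
  inv_closed : forall s, In s (cQ c) ->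
    In s (cW c) \/ forall e, enabled_abs D C s e -> processed c s e }.

Lemma alg_invariant_init : alg_invariant (alg_init Name s0).
Proof.
split=> //=; [split=> //= | by left | by move=> s; left].
- by move=> s [<-|[]]; exact: reachable_init.
- by constructor; [case | constructor].
Qed.

Lemma alg_step_invariant c c' :
  alg_invariant c -> alg_step D C c c' ->
  alg_invariant c' /\ exists new, cQ c' = new ++ cQ c /\ size (cW c') + 1 = size new + size (cW c).
Proof.
move=> [c_ok init_in W_Q closed] [s [W1 [W2 [es [W_eq [_ [es_en all]]]]]]].
have s_in : In s (cQ c) by apply: W_Q; rewrite W_eq; apply/In_cat; right; left.
have c0_ok : sound_config (Config (cQ c) (W1 ++ W2) (cTr c)) by case: c_ok; split.
have [c'_ok ext done_s] := process_all_spec all (cQ_reachable c_ok s_in)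
  (fun e h => (es_en e).1 h) c0_ok.
have [new [Q' W' _]] := ext; rewrite /= in Q' W'.
split; last by exists new; split=> //; rewrite W' W_eq !size_cat /=; lia.
have W12_Q : incl (W1 ++ W2) (cQ c).
  by move=> x /In_cat [] x_in; apply: W_Q; rewrite W_eq; apply/In_cat; [left | right; right].
split=> //.
- by rewrite Q'; apply/In_cat; right.
- by rewrite Q' W' => x /In_cat [x_new|/W12_Q x_Q]; apply/In_cat; [left | right].
- move=> x; rewrite Q' => /In_cat [x_new|x_Q]; first by left; rewrite W'; apply/In_cat; left.
  case: (closed x x_Q) => [|x_done]; last by right=> e /x_done; exact: processed_extends ext.
  rewrite W_eq => /In_cat [x_W1|[<-|x_W2]].
  + by left; rewrite W'; apply/In_cat; right; apply/In_cat; left.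
  + by right=> e /es_en; exact: done_s.
  + by left; rewrite W'; apply/In_cat; right; apply/In_cat; right.
Qed.

Lemma alg_reach_invariant c : alg_reach D C (alg_init Name s0) c -> alg_invariant c.
Proof.
by elim=> [|c1 c2 _ inv1 /(alg_step_invariant inv1) []]; first exact: alg_invariant_init.
Qed.

Hypothesis D_safe : safe D M0 a0.

Definition rval_code := {ffun Att -> option 'I_(length (regions_of C))}.

Definition decode_rval (g : rval_code) : rval Att :=
  [ffun v => omap (fun i : 'I_(length (regions_of C)) => ListDef.nth i (regions_of C) RAll) (g v)].

Lemma decode_rval_onto (rb : rval Att) :
  (forall v r, rb v = Some r -> is_region C r) -> exists g, decode_rval g = rb.
Proof.
move=> rb_C.
have /fin_all_exists [g gE] : forall v, exists o : option 'I_(length (regions_of C)),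
    omap (fun i : 'I_(length (regions_of C)) => ListDef.nth i (regions_of C) RAll) o = rb v.
  move=> v; case rbv: (rb v) => [r|]; last by exists None.
  have [k [/ltP k_lt kE]] := In_nth _ _ RAll (regions_of_complete (rb_C v r rbv)).
  by exists (Some (Ordinal k_lt)); rewrite -kE.
by exists [ffun v => g v]; apply/ffunP => v; rewrite !ffunE.
Qed.

Definition astate_code := ({ffun P -> 'I_2} * rval_code)%type.

Definition decode (x : astate_code) : astate Att P :=
  ([ffun p => nat_of_ord (x.1 p)], decode_rval x.2).

(* Safety bounds the markings of reachable states by 1. *)
Lemma decode_onto s : reachable_abs s -> exists x, decode x = s.
Proof.
case: s => M' rb [M [a [reach_a [/= -> [_ rb_C]]]]].
have [g <-] := decode_rval_onto rb_C.
exists ([ffun p => inord (M p)], g); congr pair; apply/ffunP => p.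
by rewrite !ffunE inordK // ltnS (D_safe reach_a).
Qed.

Lemma sound_config_size_le c : sound_config c -> size (cQ c) <= #|{: astate_code}|.
Proof.
move=> c_ok; apply: (NoDup_size_le_card (cQ_NoDup c_ok)) => s /(cQ_reachable c_ok).
exact: decode_onto.
Qed.

Definition measure (c : config Name Att P) : nat :=
  2 * (#|{: astate_code}| - size (cQ c)) + size (cW c).

Lemma alg_step_measure c c' :
  alg_invariant c -> alg_step D C c c' -> alg_invariant c' /\ measure c' < measure c.
Proof.
move=> inv step; have [inv' [new [Q' W']]] := alg_step_invariant inv step.
split=> //; have := sound_config_size_le (inv_sound inv'); rewrite /measure Q' size_cat in W' *.
lia.
Qed.

Lemma enabled_abs_enum s : exists es, NoDup es /\ forall e, In e es <-> enabled_abs D C s e.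
Proof.
apply: exists_NoDup_enum (list_prod (enum T) (List.map decode_rval (enum {: rval_code}))) _.
move=> [t rb] [_ [rb_C _]]; apply: in_prod; first by apply: In_mem; rewrite mem_enum.
by have [g <-] := decode_rval_onto (rb := rb) rb_C; apply: in_map; apply: In_mem; rewrite mem_enum.
Qed.

Lemma process_all_exists s es c : exists c', process_all D s es c c'.
Proof.
elim: es c => [|[t rb] es IH] c; first by exists c; constructor.
set s' := afire D s t rb.
have [psi lab_psi] : exists psi, alg_label D t s' psi.
  case: (classic (wg D t = GTrue Att)) => w_true.
  - by exists (CName Att (lab D t)); left.
  - by exists (induced_label t s'); right.
have [c1 one] : exists c1, process_one D s (t, rb) c c1.
  case: (classic (In s' (cQ c))) => s'_in.
  - by exists (Config (cQ c) (cW c) ((s, psi, s') :: cTr c)), psi; split=> //; split=> //; left.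
  - exists (Config (s' :: cQ c) (s' :: cW c) ((s, psi, s') :: cTr c)), psi.
    by split=> //; split=> //; right.
by have [c2 all] := IH c1; exists c2; exact: pa_cons one all.
Qed.

Lemma alg_step_exists c : cW c <> [::] -> exists c', alg_step D C c c'.
Proof.
case W_eq: (cW c) => [//|s W] _.
have [es [es_uniq es_en]] := enabled_abs_enum s.
have [c' all] := process_all_exists s es (Config (cQ c) ([::] ++ W) (cTr c)).
by exists c', s, [::], W, es.
Qed.

Lemma alg_terminates_init : alg_terminates D C (alg_init Name s0).
Proof.
split; last by move=> c _; exact: alg_step_exists.
exact: Acc_measure alg_step_measure _ alg_invariant_init.
Qed.

Section Output.
Variable c : config Name Att P.
Hypotheses (inv : alg_invariant c) (W_nil : cW c = [::]).

Lemma cQ_processed s e : In s (cQ c) -> enabled_abs D C s e -> processed c s e.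
Proof. by move=> /(inv_closed inv) [|done_s //]; [rewrite W_nil | exact: done_s]. Qed.

Lemma cQ_complete M a :
  reach D M0 a0 M a -> forall ra : rval Att, abs_val C a ra -> In (M, ra) (cQ c).
Proof.
elim=> {M a} [|M a t b _ IH en] ra a_ra.
  by rewrite (abs_val_uniq a_ra init_abs); exact: inv_init inv.
have [ra0 a_ra0] := abs_val_exists C a.
have [rb [en_abs fire_abs]] := @enabled_abs_complete (M, ra0) a b t a_ra0 en.
have [+ _] := cQ_processed (IH ra0 a_ra0) en_abs.
by rewrite /afire /= (abs_val_uniq a_ra fire_abs).
Qed.

Lemma In_cQ_iff s : In s (cQ c) <-> reachable_abs s.
Proof.
split=> [s_in|]; first exact: (cQ_reachable (inv_sound inv) s_in).
by case: s => M ra [M1 [a [reach_a [/= -> a_ra]]]]; exact: cQ_complete reach_a _ a_ra.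
Qed.

Lemma cTr_induced s psi s' : In (s, psi, s') (cTr c) ->
  exists psi', ind_trans D C M0 a0 s psi' s' /\ cond_equiv psi psi'.
Proof.
move=> /(cTr_sound (inv_sound inv)) [s_reach [[t rb] [en_abs -> lab_psi]]].
exists (induced_label t (afire D s t rb)).
split; last exact: alg_label_equiv lab_psi.
split=> //; split; first exact: reachable_abs_afire.
have [_ [rb_C [a [b [a_s [b_rb en]]]]]] := en_abs.
have [_ [_ [_ [_ [_ s_C]]]]] := s_reach.
have a_abs : abs_val C a s.2 by [].
exists t, a, b; split=> //; split=> //; split=> //; split=> //.
exact: (abs_val_override (wvars D t) (conj b_rb rb_C) a_abs).
Qed.

Lemma induced_in_cTr s psi s' : ind_trans D C M0 a0 s psi s' ->
  exists psi', In (s, psi', s') (cTr c) /\ cond_equiv psi psi'.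
Proof.
move=> [s_reach [_ [t [a [b [a_s [en [s'_M [fire_s' ->]]]]]]]]].
have [rb [en_abs fire_abs]] := enabled_abs_complete a_s en.
have [_ [psi' [lab_psi' tr_in]]] := cQ_processed (proj2 (In_cQ_iff s) s_reach) en_abs.
have s'E : afire D s t rb = s'.
  case: s' s'_M fire_s' {tr_in lab_psi'} => M' ra' /= -> fire_s'.
  by rewrite /afire; congr pair; exact: abs_val_uniq fire_abs fire_s'.
rewrite s'E in lab_psi' tr_in; exists psi'; split=> // n nu.
exact: iff_sym (alg_label_equiv lab_psi' n nu).
Qed.

Lemma alg_output Mf : output_is_induced D C M0 Mf a0 c.
Proof.
split; first exact: In_cQ_iff.
split; first by split=> //; exact: init_abs.
split; first by move=> s; have := In_cQ_iff s; tauto.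
by split; [exact: cTr_induced | exact: induced_in_cTr].
Qed.

End Output.

End Algorithm.

Theorem theorem1 (Name : Type) (Att P T : finType)
    (E : seq (Name * {set Att})) (D : DPN Name Att P T)
    (M0 Mf : {ffun P -> nat}) (a0 : {ffun Att -> option R}) (C : seq R) :
  List.NoDup (map fst E) ->
  DPN_over E D ->
  (forall v, v \in V D <-> a0 v <> None) ->
  safe D M0 a0 ->
  well_formed E D ->
  (forall t c, List.In c (gconsts (rg D t)) \/ List.In c (gconsts (wg D t)) -> List.In c C) ->
  (forall v x, a0 v = Some x -> List.In x C) ->
  alg_terminates D C (alg_init Name (init_astate M0 a0)) /\
  (forall c, alg_reach D C (alg_init Name (init_astate M0 a0)) c -> cW c = [::] ->
     output_is_induced D C M0 Mf a0 c).
Proof.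
move=> _ _ _ D_safe _ guard_consts init_consts.
split; first exact: alg_terminates_init.
move=> c /(alg_reach_invariant guard_consts init_consts) inv W_nil.
exact: alg_output.
Qed.
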